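(* Suppose $f:X\to X$, a continuous self-map of a topological space, has an orbit that escapes to infinity. Then: 1. $h_{AKM}(f)=\infty$. 2. If $X$ carries a totally bounded metric $d$, then for each $N\in\mathbb N$ there is a totally bounded metric $d_N$ on $X$ such that $h_{BD}(f,X,d_N)\ge N$.
   Context: The forward orbit $\{f^i(x)\}_{i\ge0}$ of a point $x\in X$ escapes to infinity in the sense that it eventually leaves every compact subset of $X$, or equivalently, it has no accumulation points (i.e. $\omega(x)=\emptyset$). Adler-Konheim-McAndrew entropy (using only finite open covers, with $X$ not assumed compact): for a finite open cover $\alpha$ of $X$, $H(\alpha)$ is the logarithm of the cardinality of a minimal subcover of $\alpha$ (a subcover of least cardinality); $\alpha_n$ is the mutual refinement of $\alpha$ together with all of its preimages under the first $n-1$ iterates of $f$; $h(f,\alpha)=\lim_{n\to\infty}\frac1nH(\alpha_n)$; and $h_{AKM}(f)=\sup\{h(f,\alpha):\alpha\text{ a finite open cover of }X\}$. A metric $d$ on $X$ is totally bounded if for every $\varepsilon>0$ there is a finite cover of $X$ by $d$-balls of radius $\varepsilon$. Metrics on $X$ are understood to induce the topology of $X$. Bowen-Dinaburg entropy: for a totally bounded metric $d$ on $X$, put $d^f_n(x,x')=\max_{0\le i<n}d(f^i(x),f^i(x'))$ for $n\ge1$. A set $S\subset X$ is $\varepsilon$-separated with respect to a metric $\delta$ if $\delta(s,s')\ge\varepsilon$ for all distinct $s,s'\in S$; $\operatorname{maxsep}[X,\delta,\varepsilon]$ is the maximal cardinality of a subset of $X$ that is $\varepsilon$-separated with respect to $\delta$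 (finite for $\delta=d^f_n$). Then $h_{BD}(f,X,d)=\lim_{\varepsilon\to0}\limsup_{n\to\infty}\frac1n\log\operatorname{maxsep}[X,d^f_n,\varepsilon]$.
   Formalization: Part 1 additionally assumes X is T1 (points are closed); without this it fails, e.g. for f(n)=n+1 on the natural numbers whose open sets are the empty set, the initial segments and the whole space, where h_AKM(f)=0. *)

(* Defs.v *)
From HB Require Import structures.
From mathcomp Require Export all_boot all_order all_algebra.
From mathcomp Require Export all_classical all_reals all_analysis.
Export numFieldNormedType.Exports.

Set Implicit Arguments.
Unset Strict Implicit.
Unset Printing Implicit Defensive.

Import Order.TTheory GRing.Theory Num.Theory.

Local Open Scope classical_set_scope.
Local Open Scope ring_scope.

Definition omega_set (X : topologicalType) (f : X -> X) (x : X) : set X :=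
  cluster ((fun i : nat => iter i f x) @ \oo).

(* For metrizable X, omega_set f x = set0 holds exactly when the orbit
   eventually leaves every compact subset; in general it is the stronger of
   the two properties. *)
Definition escapes_to_infinity (X : topologicalType) (f : X -> X) (x : X) :=
  omega_set f x = set0.

(* Least and greatest elements of a set of natural numbers; both take the junk
   value 0 when there is no such element. *)
Definition nat_least (A : set nat) : nat :=
  xget 0%N [set n | A n /\ forall m, A m -> (n <= m)%N].

Definition nat_greatest (A : set nat) : nat :=
  xget 0%N [set n | A n /\ forall m, A m -> (m <= n)%N].

Definition is_cover (X : Type) (alpha : set (set X)) : Prop :=
  cover alpha id = setT.

Definition finite_open_cover (X : topologicalType) (alpha : set (set X)) :=
  [/\ finite_set alpha, (forall A, alpha A -> open A) & is_cover alpha].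

Definition subcover_card (X : Type) (alpha : set (set X)) : nat :=
  nat_least [set n | exists beta : set (set X),
    [/\ beta `<=` alpha, is_cover beta & (beta #= `I_n)%card]].

(* Members are A_0 `&` f^{-1}(A_1) `&` ... `&` f^{-(n-1)}(A_{n-1}) with
   A_0, ..., A_{n-1} in alpha. *)
Definition iterated_refinement (X : Type) (f : X -> X) (alpha : set (set X))
    (n : nat) : set (set X) :=
  [set \bigcap_(i in `I_n) (iter i f @^-1` A i) |
     A in [set A : nat -> set X | forall i, (i < n)%N -> alpha (A i)]].

Section entropy.
Context {R : realType}.
Local Open Scope ereal_scope.

Definition H_cover (X : Type) (alpha : set (set X)) : R :=
  ln (subcover_card alpha)%:R.

Definition h_cover (X : Type) (f : X -> X) (alpha : set (set X)) : R :=
  limn (fun n : nat => (n%:R^-1 * H_cover (iterated_refinement f alpha n))%R).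

Definition h_AKM (X : topologicalType) (f : X -> X) : \bar R :=
  ereal_sup [set (h_cover f alpha)%:E | alpha in @finite_open_cover X].

(* Unbundled rather than a metricType: different metrics are compared on one
   fixed topology, which each of them must induce. *)
Record metric_on (X : topologicalType) (d : X -> X -> R) : Prop := MetricOn {
  metric_refl : forall x, d x x = 0%R;
  metric_eq : forall x y, d x y = 0%R -> x = y;
  metric_symm : forall x y, d x y = d y x;
  metric_trian : forall x y z, (d x z <= d x y + d y z)%R;
  metric_nbhs : forall (x : X) (A : set X),
    nbhs x A <-> exists2 e : R, (0 < e)%R & [set y | (d x y < e)%R] `<=` A }.

Definition totally_bounded_metric (X : Type) (d : X -> X -> R) : Prop :=
  forall e : R, (0 < e)%R -> exists2 C : set X, finite_set C &
    \bigcup_(c in C) [set y | (d c y < e)%R] = setT.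

(* The base value 0 of the maximum is harmless because d is nonnegative. *)
Definition bowen_metric (X : Type) (f : X -> X) (d : X -> X -> R) (n : nat)
    (x x' : X) : R :=
  \big[Num.max/0%R]_(i < n) d (iter i f x) (iter i f x').

Definition separated_set (X : Type) (delta : X -> X -> R) (e : R)
    (S : set X) : Prop :=
  forall s s', S s -> S s' -> s <> s' -> (e <= delta s s')%R.

Definition maxsep (X : Type) (delta : X -> X -> R) (e : R) : nat :=
  nat_greatest [set n | exists2 S : set X, separated_set delta e S & (S #= `I_n)%card].

Definition h_BD (X : Type) (f : X -> X) (d : X -> X -> R) : \bar R :=
  lim ((fun e : R => limn_esup (fun n : nat =>
    (n%:R^-1 * ln (maxsep (bowen_metric f d n) e)%:R)%:E)) @ 0%R^'+).

End entropy.

(* Main.v *)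
From HB Require Import structures.
Require Import Defs.
From mathcomp Require Import zify lra.

Set Implicit Arguments.
Unset Strict Implicit.
Unset Printing Implicit Defensive.

Import Order.TTheory GRing.Theory Num.Theory.

Local Open Scope classical_set_scope.
Local Open Scope ring_scope.

(** An orbit x, f x, f^2 x, ... without accumulation points is injective, and in
a T1 space every subset of it is closed ([escaping_orbit_closed]).  Hence its
points may be coloured at will, without any topological obstruction, and the
dynamics of f along the orbit reads off the colours one after the other.  Take
k colours and a sequence of colours in which every finite word occurs
([universal_colouring]): among the itineraries of length n of the points of the
orbit all k ^ n words are found.

For open covers, let the member of colour j be the complement of the orbit
points of the other colours.  These k sets form an open cover, and an orbit
point lies in exactly one member of the n-th refinement, the one labelled by
the next n colours that it meets.  So no member of the refinement can be spared
([subcover_card_colour]), the refinement has k ^ n members, the entropy of the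
cover is ln k, and k is arbitrary.

For metrics, the colouring, read as a bounded real function on the closed
discrete orbit, extends to a bounded continuous function g on X by Tietze's
theorem ([extend_orbit_function]; X is normal, being metrizable).  The metric
d x y + |g x - g y| induces the same topology, is still totally bounded since g
is bounded, and separates points of different colours by at least 1.  Two orbit
points with different itineraries of length n are then 1-separated in the
n-th Bowen metric, which gives k ^ n separated points ([maxsep_coloured]) and
an entropy of at least ln k ([h_BD_ge]).

The numbers [maxsep] and the limit in [h_BD] have their intended meaning only if
separated sets have bounded cardinality and the limit exists.  Both come from
[finitely_partitioned]: X is cut into finitely many pieces of small diameter, a
property equivalent to total boundedness for metrics but visibly inherited by
sums and by Bowen metrics. *)

(** * A sequence of colours containing every word *)

Lemma size_code (s : seq nat) : (size s <= CodeSeq.code s)%N.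
Proof.
elim: s => //= a s IHs; rewrite -/(CodeSeq.code s).
apply: (@leq_trans (CodeSeq.code s).*2.+1); first by lia.
by rewrite leq_pmull // expn_gt0.
Qed.

(** The word with code k is written on the positions 2 ^ k, 2 ^ k + 1, ...; the
block up to 2 ^ (k + 1) has room for it because a word is no longer than its
code. *)
Lemma universal_colouring (K : nat) : exists c : nat -> 'I_K.+1,
  forall (n : nat) (w : {ffun 'I_n -> 'I_K.+1}),
    exists m, forall i : 'I_n, c (m + i)%N = w i.
Proof.
pose blk m := trunc_log 2 m.
exists (fun m => inord (nth 0%N (CodeSeq.decode (blk m)) (m - 2 ^ blk m))).
move=> n w; pose s := [seq (w i : nat) | i <- enum 'I_n].
have szs : size s = n by rewrite size_map size_enum_ord.
exists (2 ^ CodeSeq.code s)%N => i.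
have -> : blk (2 ^ CodeSeq.code s + i)%N = CodeSeq.code s.
  apply: trunc_log_eq => //; rewrite leq_addr expnS mul2n -addnn ltn_add2l /=.
  apply: leq_trans (ltn_ord i) _; rewrite -szs (leq_trans (size_code s)) //.
  exact: ltnW (ltn_expl _ _).
rewrite CodeSeq.codeK addKn (nth_map i) ?size_enum_ord // nth_ord_enum.
exact: inord_val.
Qed.

(** * Escaping orbits *)

Section escaping_orbit.
Context (X : topologicalType) (f : X -> X) (x : X).
Hypothesis hesc : escapes_to_infinity f x.

Lemma escaping_nbhs (y : X) : exists2 B, nbhs y B &
  exists N, forall n, (N <= n)%N -> ~ B (iter n f x).
Proof.
have /existsNP[A /existsNP[B]] : ~ omega_set f x y by rewrite hesc.
move=> /not_implyP[/= [N _ hN]] /not_implyP[yB] /set0P/negP; rewrite negbK.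
move=> /eqP AB0; exists B => //; exists N => n Nn Bn.
by have : set0 (iter n f x) by rewrite -AB0; split=> //; exact: hN.
Qed.

(** A repetition makes the orbit eventually periodic, and a periodic point is an
accumulation point of its orbit. *)
Lemma escaping_orbit_inj : injective (fun n => iter n f x).
Proof.
suff lt_neq m n : (m < n)%N -> iter m f x <> iter n f x.
  move=> m n /= mn; case: (ltngtP m n) => // h; first by case: (lt_neq _ _ h).
  by case: (lt_neq _ _ h).
move=> ltmn mn.
have per k : iter (m + k * (n - m)) f x = iter m f x.
  elim: k => [|k IHk]; first by rewrite addn0.
  rewrite mulSn addnA addnAC addnC iterD IHk -iterD.
  by rewrite subnK ?mn // ltnW.
have [B /nbhs_singleton yB [N hN]] := escaping_nbhs (iter m f x).
apply: (hN (m + N * (n - m))%N); last by rewrite per.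
by rewrite -subn_gt0 in ltmn; nia.
Qed.

(** Near any point only finitely many points of the orbit are met, and in a T1
space these finitely many can be removed from a neighbourhood. *)
Lemma escaping_orbit_closed (S : set nat) : accessible_space X ->
  closed ((fun n => iter n f x) @` S).
Proof.
move=> accX; rewrite -openC openE => y /= ySn.
have [B yB [N hN]] := escaping_nbhs y.
pose T := (fun n => iter n f x) @` (S `&` `I_N).
have clT : closed T.
  apply: (iffLR accessible_finite_set_closed accX); apply: finite_image.
  by apply: sub_finite_set (finite_II N) => n [].
have yT : nbhs y (~` T).
  apply: open_nbhs_nbhs; split; first exact: closed_openC.
  by move=> [n [Sn _] ny]; apply: ySn; exists n.
apply: filterS (filterI yB yT) => z [Bz Tz] [n Sn nz].
have [Nn|nN] := leqP N n; first by apply: (hN n) => //; rewrite nz.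
by apply: Tz; exists n.
Qed.

End escaping_orbit.

(** * Covers coloured along the orbit *)

Lemma card_eq_finType (T : finType) : ([set: T] #= `I_#|T|)%card.
Proof.
have inj : {in [set: T] &, injective (fun t => enum_rank t : nat)}.
  by move=> s t _ _ /ord_inj /enum_rank_inj.
rewrite -(card_eql (inj_card_eq inj)).
suff -> : (fun t : T => enum_rank t : nat) @` setT = `I_#|T| by exact: card_eqxx.
apply/seteqP; split=> [_ [t _ <-]|k /= ltk]; first exact: ltn_ord.
by exists (enum_val (Ordinal ltk)) => //; rewrite enum_valK.
Qed.

Lemma exists_le_ln (R : realType) (r : R) : exists K : nat, r <= ln K.+1%:R.
Proof.
exists (Num.bound (expR r)); rewrite -[r in r <= _]expRK.
rewrite ler_ln ?posrE ?expR_gt0 ?ltr0n //.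
by rewrite (le_trans (ltW (archi_boundP (expR_ge0 r)))) // ler_nat leqnSn.
Qed.

Section colour_covers.
Context (R : realType) (X : topologicalType) (f : X -> X) (x : X).
Hypothesis hesc : escapes_to_infinity f x.
Hypothesis accX : accessible_space X.

Section colour_cover.
Context (K : nat) (c : nat -> 'I_K.+1).

Definition colour_member (j : 'I_K.+1) : set X :=
  ~` ((fun n => iter n f x) @` [set n | c n != j]).

Lemma colour_member_orbit n j : colour_member j (iter n f x) <-> c n = j.
Proof.
split=> [|<-].
  by move=> cn; apply: contrapT => /eqP nj; apply: cn; exists n.
by move=> [m /= cm /(escaping_orbit_inj hesc) mn]; rewrite mn eqxx in cm.
Qed.

Lemma colour_member_cover (y : X) : exists j, colour_member j y.
Proof.
have [[n _ <-]|nO] := pselect (range (fun n => iter n f x) y).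
  by exists (c n); apply/colour_member_orbit.
by exists ord0 => -[n _ ny]; apply: nO; exists n.
Qed.

Lemma colour_cover_open : finite_open_cover (range colour_member).
Proof.
split.
- exact: finite_image.
- by move=> _ [j _ <-]; apply: closed_openC; exact: escaping_orbit_closed.
- apply/seteqP; split => // y _; have [j yj] := colour_member_cover y.
  by exists (colour_member j) => //; exists j.
Qed.

Definition word_member n (w : {ffun 'I_n -> 'I_K.+1}) : set X :=
  [set y | forall i : 'I_n, colour_member (w i) (iter i f y)].

Lemma iterated_refinement_colour n :
  iterated_refinement f (range colour_member) n = range (@word_member n).
Proof.
apply/seteqP; split=> [_ [A hA <-]|_ [w _ <-]].
  have /choice[w hw] (i : 'I_n) : exists j, colour_member j = A i.
    by have [j _ <-] := hA _ (ltn_ord i); exists j.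
  exists (finfun w) => //; apply/seteqP; split=> y /= hy i.
    by move=> /= ltin; have := hy (Ordinal ltin); rewrite ffunE hw.
  by rewrite ffunE hw; exact: hy (ltn_ord i).
exists (fun i => colour_member (if insub i is Some k then w k else ord0)).
  by move=> i _; exists (if insub i is Some k then w k else ord0).
apply/seteqP; split=> y /= hy i; last first.
  by move=> /= ltin; rewrite insubT; exact: (hy (Ordinal ltin)).
by have := hy i (ltn_ord i); rewrite /= valK.
Qed.

Hypothesis hc : forall n (w : {ffun 'I_n -> 'I_K.+1}),
  exists m, forall i : 'I_n, c (m + i)%N = w i.

(** The orbit point from which the colours spell w lies in no other member of the
refinement. *)
Lemma word_member_witness n (w : {ffun 'I_n -> 'I_K.+1}) :
  exists2 y, word_member w y & forall v, word_member v y -> v = w.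
Proof.
have [m hm] := hc w; exists (iter m f x) => [i|v hv].
  by rewrite -iterD addnC; apply/colour_member_orbit.
apply/ffunP => i; have := hv i; rewrite -iterD addnC => /colour_member_orbit.
by rewrite hm.
Qed.

(** By the witnesses, a subcover must contain all members and different words
have different members. *)
Lemma subcover_card_colour n :
  subcover_card (iterated_refinement f (range colour_member) n) = (K.+1 ^ n)%N.
Proof.
rewrite iterated_refinement_colour.
have W_inj : injective (@word_member n).
  move=> v w vw; have [y _ hy] := word_member_witness w.
  have [z hz hz'] := word_member_witness v.
  by symmetry; apply: hz'; rewrite -vw.
have cardW k : (range (@word_member n) #= `I_k)%card <-> k = (K.+1 ^ n)%N.
  have -> : (K.+1 ^ n = #|{ffun 'I_n -> 'I_K.+1}|)%N.
    by rewrite card_ffun !card_ord.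
  have /card_eql -> : (range (@word_member n) #= `I_#|{ffun 'I_n -> 'I_K.+1}|)%card.
    apply: card_eq_trans (card_eq_finType _).
    by apply: inj_card_eq => v w _ _; exact: W_inj.
  by split=> [/card_eq_II|->//].
have sub_eq beta : beta `<=` range (@word_member n) -> is_cover beta ->
    beta = range (@word_member n).
  move=> sub cov; apply/seteqP; split=> // _ [w _ <-].
  have [y wy hy] := word_member_witness w.
  have : (cover beta id) y by rewrite cov.
  by move=> [B betaB By]; have [v _ vB] := sub _ betaB;
    rewrite -(hy v) ?vB.
have cov : is_cover (range (@word_member n)).
  apply/seteqP; split=> // y _.
  have /choice[w hw] (i : 'I_n) := colour_member_cover (iter i f y).
  exists (word_member (finfun w)); first by exists (finfun w).
  by move=> i; rewrite ffunE.
rewrite /subcover_card /nat_least.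
case: xgetP => [k ->{k} [[beta [sub cb]] + _] | /(_ (K.+1 ^ n)%N) []].
  by rewrite (sub_eq _ sub cb) => /cardW.
split; first by exists (range (@word_member n)); split=> //; apply/cardW.
by move=> m [beta [sub cb]]; rewrite (sub_eq _ sub cb) => /cardW ->.
Qed.

Lemma h_cover_colour :
  h_cover f (range colour_member) = ln K.+1%:R :> R.
Proof.
apply: lim_near_cst => //; exists 1%N => // n /= n_gt0.
rewrite /H_cover subcover_card_colour natrX lnXn ?ltr0n // -[X in _ * X]mulr_natl.
by rewrite mulKf // pnatr_eq0 -lt0n.
Qed.

End colour_cover.

Lemma h_AKM_escaping : h_AKM f = +oo%E :> \bar R.
Proof.
apply: eq_infty => r; have [K leK] := exists_le_ln r.
have [c hc] := universal_colouring K.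
apply: (@le_trans _ _ (ln K.+1%:R)%:E); first by rewrite lee_fin.
apply: ereal_sup_ubound; exists (range (colour_member c)).
  exact: colour_cover_open.
by rewrite h_cover_colour.
Qed.

End colour_covers.

(** * Topology of a metric given by a distance function *)

Section metric_facts.
Context (R : realType) (X : topologicalType) (d : X -> X -> R).
Hypothesis hd : metric_on d.

Lemma metric_ge0 x y : 0 <= d x y.
Proof.
by have := metric_trian hd x y x; rewrite (metric_refl hd) (metric_symm hd y); lra.
Qed.

Lemma metric_ball_nbhs x e : 0 < e -> nbhs x [set y | d x y < e].
Proof. by move=> e0; apply/(metric_nbhs hd); exists e. Qed.

Lemma metric_accessible : accessible_space X.
Proof.
move=> x y /eqP xy; have dxy : 0 < d x y.
  rewrite lt_neqAle metric_ge0 andbT eq_sym; apply/eqP => /(metric_eq hd).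
  exact: xy.
exists [set z | d x z < d x y]°; split; first exact: open_interior.
  by apply/mem_set; exact: metric_ball_nbhs.
by apply/mem_set => /interior_subset /=; rewrite ltxx.
Qed.

End metric_facts.

(** A copy of X on which d can be registered as a pseudometric structure.  The
neighbourhood filters of the copy are those of X up to conversion, so that
normality of the copy is normality of X. *)
Definition metrized (R : realType) (X : topologicalType) (d : X -> X -> R)
  (hd : metric_on d) : Type := X.

Section metrized.
Context (R : realType) (X : topologicalType) (d : X -> X -> R).
Variable hd : metric_on d.

HB.instance Definition _ := Choice.on (metrized hd).
HB.instance Definition _ := hasNbhs.Build (metrized hd) (@nbhs X X).

Let ball (x : metrized hd) (e : R) (y : metrized hd) : Prop := d x y < e.

Let nbhs_ball : @nbhs _ (metrized hd) = nbhs_ (entourage_ ball).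
Proof.
apply/funext => x; apply/funext => A.
apply: etrans (propext (metric_nbhs hd x A)) _; apply/propext.
split=> [[e e0 sub]|[E [e /= e0 sub] subA]].
  exists [set xy | ball xy.1 e xy.2]; first by exists e.
  by move=> y /set_mem; exact: sub.
by exists e => // y dy; apply: subA; apply/mem_set; exact: (sub (x, y)).
Qed.

Let ball_center (x : metrized hd) (e : R) : 0 < e -> ball x e x.
Proof. by rewrite /ball (metric_refl hd). Qed.

Let ball_sym (x y : metrized hd) (e : R) : ball x e y -> ball y e x.
Proof. by rewrite /ball (metric_symm hd). Qed.

Let ball_triangle (x y z : metrized hd) (e1 e2 : R) :
  ball x e1 y -> ball y e2 z -> ball x (e1 + e2) z.
Proof.
by move=> xy yz; apply: le_lt_trans (metric_trian hd x y z) (ltrD xy yz).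
Qed.

HB.instance Definition _ := @Nbhs_isPseudoMetric.Build R (metrized hd)
  (entourage_ ball) nbhs_ball ball ball_center ball_sym ball_triangle erefl.

Lemma metric_normal : normal_space X.
Proof. exact: (@pseudometric_normal R (metrized hd)). Qed.

End metrized.

(** * Perturbing a metric by a function on the orbit *)

Section tietze.
Context (R : realType) (X : topologicalType) (f : X -> X) (x : X).
Hypothesis hesc : escapes_to_infinity f x.
Hypothesis accX : accessible_space X.
Hypothesis normX : normal_space X.

(** The orbit is closed and discrete, so every function on it is continuous.
The bound M + 1 instead of M spares the case M = 0, where Tietze's theorem with
a positive bound does not apply. *)
Lemma extend_orbit_function (u : nat -> R) (M : R) : (forall n, `|u n| <= M) ->
  exists g : X -> R, [/\ continuous g, forall n, g (iter n f x) = u n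
    & forall y, `|g y| <= M + 1].
Proof.
move=> uM; pose orb n := iter n f x.
pose v y := if pselect (range orb y) is left yO then u (projT1 (cid2 yO)) else 0.
have v_orb n : v (orb n) = u n.
  rewrite /v; case: pselect => [nO|[]]; last by exists n.
  by case: cid2 => m /= _ /(escaping_orbit_inj hesc) ->.
have M1 : 0 < M + 1 by have := uM 0%N; have := normr_ge0 (u 0%N); lra.
have clO S : closed (orb @` S) by exact: escaping_orbit_closed.
have v_cont : {within range orb, continuous (v : X -> R^o)}.
  apply/subspace_continuousP => _ [n _ <-] A /nbhs_singleton vA.
  have : nbhs (orb n) (~` (orb @` [set m | m != n])).
    apply: open_nbhs_nbhs; split; first exact: closed_openC.
    by move=> [m /= mn /(escaping_orbit_inj hesc) mn']; rewrite mn' eqxx in mn.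
  apply: filterS => y nm [m _ my]; suff mn : m = n by rewrite /= -my mn.
  by apply: contrapT => /eqP mn; apply: nm; exists m.
have v_bnd y : range orb y -> `|v y| <= M + 1.
  by move=> [n _ <-]; rewrite v_orb (le_trans (uM n)) // lerDl.
have [g [vg g_cont g_bnd]] :=
  continuous_bounded_extension normX (clO setT) M1 v_cont v_bnd.
exists g; split=> // n; rewrite -vg ?v_orb //.
by apply/mem_set; exists n.
Qed.

End tietze.

Section perturbed_metric.
Context (R : realType) (X : topologicalType) (d : X -> X -> R) (g : X -> R).
Hypothesis hd : metric_on d.
Hypothesis hg : continuous g.

Definition perturbed_metric (x y : X) : R := d x y + `|g x - g y|.

Lemma perturbed_metric_on : metric_on perturbed_metric.
Proof.
rewrite /perturbed_metric; split.
- by move=> x; rewrite (metric_refl hd) subrr normr0 addr0.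
- move=> x y /eqP; rewrite paddr_eq0 ?metric_ge0 //.
  by move=> /andP[/eqP /(metric_eq hd)].
- by move=> x y; rewrite (metric_symm hd) distrC.
- move=> x y z; rewrite addrACA lerD ?(metric_trian hd) //.
  exact: ler_distD.
- move=> x A; split=> [/(metric_nbhs hd)[e e0 sub]|[e e0 sub]].
    exists e => // y /= xy; apply: sub; apply: le_lt_trans xy.
    by rewrite lerDl.
  have e2 : 0 < e / 2 by rewrite divr_gt0.
  have : nbhs x [set y | `|g x - g y| < e / 2].
    by move/(_ x)/cvgrPdist_lt : hg; exact.
  move=> /(filterI (metric_ball_nbhs hd x e2)); apply: filterS => y /= [dy gy].
  by apply: sub => /=; rewrite [e]splitr ltrD.
Qed.

End perturbed_metric.

(** * Partitions into small pieces *)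

Section finite_partitions.
Context (R : realType) (X : Type).
Implicit Types d : X -> X -> R.

(** Total boundedness phrased by labels: points with the same label are close.
Being a statement about labellings rather than centres of balls, it passes to
sums and maxima by pairing labels. *)
Definition finitely_partitioned d := forall e, 0 < e ->
  exists (T : finType) (p : X -> T), forall x y, p x = p y -> d x y < e.

Lemma finitely_partitioned_bounded (g : X -> R) (M : R) :
  (forall x, `|g x| <= M) -> finitely_partitioned (fun x y => `|g x - g y|).
Proof.
move=> gM e e0.
(* the label of y is the index of the interval of length e containing g y + M *)
pose L := Num.bound (2 * M / e).
have q_ge0 y : 0 <= (g y + M) / e.
  by apply: divr_ge0 (ltW e0); have := gM y; rewrite ler_norml; lra.
have qL y : (g y + M) / e < L%:R.
  apply: le_lt_trans (_ : 2 * M / e < _).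
    by rewrite ler_pdivrMr // divfK ?gt_eqF //; have := gM y; rewrite ler_norml; lra.
  apply: archi_boundP; apply: divr_ge0 (ltW e0).
  have := gM y; have := normr_ge0 (g y); lra.
have tL y : (Num.truncn ((g y + M) / e) < L.+1)%N.
  by rewrite ltnS -(ler_nat R) (le_trans _ (ltW (qL y))) // truncn_le.
exists 'I_L.+1, (fun y => Ordinal (tL y)) => y z [] yz.
have := truncn_itv (q_ge0 y); have := truncn_itv (q_ge0 z); rewrite yz.
rewrite ler_pdivlMr // ltr_pdivrMr // ler_pdivlMr // ltr_pdivrMr //.
set k := Num.truncn _; rewrite -natr1 mulrDl mul1r => /andP[z1 z2] /andP[y1 y2].
by rewrite ltr_norml; lra.
Qed.

Lemma finitely_partitionedD d1 d2 : finitely_partitioned d1 ->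
  finitely_partitioned d2 -> finitely_partitioned (fun x y => d1 x y + d2 x y).
Proof.
move=> h1 h2 e e0; have e2 : 0 < e / 2 by rewrite divr_gt0.
have [T1 [p1 hp1]] := h1 _ e2; have [T2 [p2 hp2]] := h2 _ e2.
exists (T1 * T2)%type, (fun x => (p1 x, p2 x)) => x y [/hp1 xy1 /hp2 xy2].
by rewrite [e]splitr ltrD.
Qed.

Lemma finitely_partitioned_bowen d (f : X -> X) n :
  finitely_partitioned d -> finitely_partitioned (bowen_metric f d n).
Proof.
move=> hd e e0; have [T [p hp]] := hd e e0.
exists {ffun 'I_n -> T}, (fun x => [ffun i : 'I_n => p (iter i f x)]).
move=> x y /ffunP xy; apply: bigmax_lt => // i _; apply: hp.
by have := xy i; rewrite !ffunE.
Qed.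

Lemma finitely_partitioned_totally_bounded d :
  finitely_partitioned d -> totally_bounded_metric d.
Proof.
move=> hd e e0; have [T [p hp]] := hd e e0.
have /choice[c hc] (t : T) : exists C, finite_set C /\
    forall x, p x = t -> exists2 y, C y & p y = t.
  have [[x xt]|nt] := pselect (exists x, p x = t); last first.
    by exists set0; split=> [//|x xt]; case: nt; exists x.
  by exists [set x]; split; [exact: finite_set1 | exists x].
exists (\bigcup_t c t).
  by apply: bigcup_finite => [|t _]; [exact: finite_finset|exact: (hc t).1].
apply/seteqP; split=> // y _; have [z cz zy] := (hc (p y)).2 y erefl.
by exists z; [exists (p y) | exact: hp].
Qed.

End finite_partitions.

Lemma totally_bounded_finitely_partitioned (R : realType) (X : topologicalType)
    (d : X -> X -> R) : metric_on d ->
  totally_bounded_metric d -> finitely_partitioned d.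
Proof.
move=> hd tb e e0; have e2 : 0 < e / 2 by rewrite divr_gt0.
have [C /finite_seqP[s ->{C}] cov] := tb _ e2.
have /choice[p hp] y : exists t : seq_sub s, d (val t) y < e / 2.
  have : (\bigcup_(c in [set` s]) [set z | d c z < e / 2]) y by rewrite cov.
  by move=> [c /= cs cy]; exists (SeqSub cs).
exists (seq_sub s), p => y z yz; rewrite [e]splitr.
apply: le_lt_trans (metric_trian hd y (val (p y)) z) _.
by rewrite (metric_symm hd y) ltrD ?hp // yz.
Qed.

(** * Separated sets and the Bowen entropy *)

Section separation.
Context (R : realType) (X : Type).
Implicit Types d : X -> X -> R.

(** Two points of a separated set never share a label. *)
Lemma separated_card d e : 0 < e -> finitely_partitioned d ->
  exists m, forall (S : set X) n,
    separated_set d e S -> (S #= `I_n)%card -> (n <= m)%N.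
Proof.
move=> e0 hd; have [T [p hp]] := hd e e0; exists #|T| => S n sepS cardS.
rewrite -card_le_II.
have inj : {in S &, injective p}.
  move=> y z /set_mem Sy /set_mem Sz yz; apply: contrapT => nyz.
  by have := sepS y z Sy Sz nyz; rewrite leNgt hp.
have := inj_card_eq inj; rewrite (card_eqr cardS) => pS.
rewrite -(card_le_eqr (card_eq_finType T)) -(card_le_eql pS).
exact: subset_card_le.
Qed.

Lemma nat_greatestP (A : set nat) k : A k ->
  (exists m, forall n, A n -> (n <= m)%N) ->
  A (nat_greatest A) /\ forall n, A n -> (n <= nat_greatest A)%N.
Proof.
move=> Ak [m hm]; rewrite /nat_greatest.
case: xgetP => [n _ //|none].
have exA : exists n, `[< A n >] by exists k; apply/asboolP.
have leA n : `[< A n >] -> (n <= m)%N by move=> /asboolP /hm.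
case: (ex_maxnP exA leA) => n /asboolP An hn.
by case: (none n); split=> // j Aj; apply: hn; apply/asboolP.
Qed.

Lemma maxsepP d e : 0 < e -> finitely_partitioned d ->
  (exists2 S, separated_set d e S & (S #= `I_(maxsep d e))%card) /\
  (forall S n, separated_set d e S -> (S #= `I_n)%card -> (n <= maxsep d e)%N).
Proof.
move=> e0 hd.
have [] := @nat_greatestP
  [set n | exists2 S : set X, separated_set d e S & (S #= `I_n)%card] 0%N.
- by exists set0 => [? ? []|]; rewrite II0.
- have [m hm] := separated_card e0 hd; exists m => n [S sepS cardS].
  exact: hm sepS cardS.
by move=> h1 h2; split=> // S n sepS cardS; apply: h2; exists S.
Qed.

Lemma maxsep_anti d e e' : finitely_partitioned d -> 0 < e -> e <= e' ->
  (maxsep d e' <= maxsep d e)%N.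
Proof.
move=> hd e0 ee'; have e'0 := lt_le_trans e0 ee'.
have [[S sepS cardS] _] := maxsepP e'0 hd.
apply: (maxsepP e0 hd).2 cardS => y z Sy Sz yz.
exact: le_trans ee' (sepS _ _ Sy Sz yz).
Qed.

End separation.

Lemma ler_ln_nat (R : realType) (m n : nat) : (m <= n)%N ->
  ln m%:R <= ln n%:R :> R.
Proof.
case: m => [|m] mn; last by rewrite ler_ln ?ler_nat // posrE ltr0n // (leq_trans _ mn).
rewrite ln0 //; case: n mn => [|n _]; first by rewrite ln0.
by rewrite ln_ge0 // ler1n.
Qed.

Lemma le_limn_esup (R : realType) (u v : nat -> \bar R) :
  (forall n, (u n <= v n)%E) -> (limn_esup u <= limn_esup v)%E.
Proof.
move=> uv; apply: le_ereal_inf_tmp => _ [V Vinf <-].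
apply: (@le_trans _ _ (ereal_sup (u @` V))).
  by apply: ereal_inf_lbound; exists V.
apply: ge_ereal_sup => _ [n Vn <-]; apply: le_trans (uv n) _.
by apply: ereal_sup_ubound; exists n.
Qed.

Lemma limn_esup_ge (R : realType) (u : nat -> \bar R) (l : \bar R) :
  (\forall n \near \oo, (l <= u n)%E) -> (l <= limn_esup u)%E.
Proof.
move=> lu; apply: le_ereal_inf_tmp => _ [V Vinf <-].
have [n [Vn ln]] := filter_ex (filterI Vinf lu).
by apply: le_trans ln _; apply: ereal_sup_ubound; exists n.
Qed.

(** One scale e0 suffices: the growth rate does not decrease as the scale shrinks,
so the limit at 0 exists and dominates the rate at e0. *)
Lemma h_BD_ge (R : realType) (X : Type) (f : X -> X) (d : X -> X -> R)
    (K : nat) (e0 : R) : finitely_partitioned d -> 0 < e0 ->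
  (forall n, (K.+1 ^ n <= maxsep (bowen_metric f d n) e0)%N) ->
  ((ln K.+1%:R)%:E <= h_BD f d)%E.
Proof.
move=> hd e0_gt0 hK; have hb n := finitely_partitioned_bowen f n hd.
have ln_ge e n : 0 < e -> e <= e0 -> (0 < n)%N ->
    ln K.+1%:R <= n%:R^-1 * ln (maxsep (bowen_metric f d n) e)%:R :> R.
  move=> e_gt0 ee0 n_gt0; rewrite ler_pdivlMl ?ltr0n // mulr_natl.
  rewrite -lnXn ?ltr0n // -natrX; apply: ler_ln_nat.
  exact: leq_trans (hK n) (maxsep_anti (hb n) e_gt0 ee0).
apply: lime_ge.
  apply: nonincreasing_at_right_is_cvge; near=> b => y z.
  rewrite !in_itv /= => /andP[y0 _] /andP[z0 _] yz.
  apply: le_limn_esup => n; rewrite lee_fin ler_wpM2l ?invr_ge0 ?ler0n //.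
  by apply: ler_ln_nat; exact: maxsep_anti.
near=> e; apply: limn_esup_ge; exists 1%N => // n /= n_gt0.
rewrite lee_fin ln_ge //; near: e.
exact: nbhs_right_le.
Unshelve. all: by end_near. Qed.

Section coloured_metric.
Context (R : realType) (X : topologicalType) (f : X -> X) (x : X).
Context (d : X -> X -> R) (g : X -> R) (K : nat) (c : nat -> 'I_K.+1).
Hypothesis hd : metric_on d.
Hypothesis tbd : finitely_partitioned (perturbed_metric d g).
Hypothesis gc : forall n, g (iter n f x) = (c n : nat)%:R.
Hypothesis hc : forall n (w : {ffun 'I_n -> 'I_K.+1}),
  exists m, forall i : 'I_n, c (m + i)%N = w i.

(** The points from which the colours spell the words of length n; colours are
integers, so different ones are at distance at least 1. *)
Lemma maxsep_coloured n :
  (K.+1 ^ n <= maxsep (bowen_metric f (perturbed_metric d g) n) 1)%N.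
Proof.
have /choice[m hm] := @hc n.
pose pt w := iter (m w) f x.
have g_pt (w : {ffun 'I_n -> 'I_K.+1}) (i : 'I_n) :
    g (iter i f (pt w)) = (w i : nat)%:R.
  by rewrite -iterD addnC gc hm.
have pt_inj : {in [set: {ffun 'I_n -> 'I_K.+1}] &, injective pt}.
  move=> v w _ _ vw; apply/ffunP => i; apply/ord_inj/eqP.
  by rewrite -(eqr_nat R) -!g_pt vw.
have -> : (K.+1 ^ n = #|{ffun 'I_n -> 'I_K.+1}|)%N by rewrite card_ffun !card_ord.
have [_ max] := maxsepP (@ltr01 R) (finitely_partitioned_bowen f n tbd).
apply: max (card_eq_trans (inj_card_eq pt_inj) (card_eq_finType _)).
move=> _ _ [v _ <-] [w _ <-] vw.
have [i vwi] : exists i, v i != w i.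
  apply/existsP; rewrite -negb_forall; apply/negP => /forallP vwE; apply: vw.
  by congr pt; apply/ffunP => i; apply/eqP.
apply: le_trans (le_bigmax _ _ i); rewrite /perturbed_metric !g_pt.
rewrite ler_wpDl ?metric_ge0 //.
have {vwi} : (v i : nat) != w i by apply: contra vwi => /eqP/ord_inj/eqP.
set a := nat_of_ord _; set b := nat_of_ord _.
rewrite neq_ltn => /orP[]; rewrite -(ler_nat R) -natr1 => ab.
  by rewrite distrC ler_normr; apply/orP; left; lra.
by rewrite ler_normr; apply/orP; left; lra.
Qed.

End coloured_metric.

Local Open Scope ereal_scope.

Theorem proposition7 (R : realType) (X : topologicalType) (f : X -> X)
    (hf : continuous f) (hesc : exists x : X, escapes_to_infinity f x) :
  (accessible_space X -> h_AKM f = +oo :> \bar R) /\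
  (forall d : X -> X -> R, metric_on d -> totally_bounded_metric d ->
   forall N : nat, exists dN : X -> X -> R,
     [/\ metric_on dN, totally_bounded_metric dN & (N%:R)%:E <= h_BD f dN]).
Proof.
have [x hx] := hesc; split=> [accX|d hd tbd N]; first exact: h_AKM_escaping hx accX.
have [K leK] := exists_le_ln (N%:R : R).
have [c hc] := universal_colouring K.
have c_bnd n : (`|(c n : nat)%:R : R| <= K%:R)%R.
  by rewrite ger0_norm ?ler0n // ler_nat -ltnS ltn_ord.
have [g [g_cont gc g_bnd]] :=
  extend_orbit_function hx (metric_accessible hd) (metric_normal hd) c_bnd.
have fp : finitely_partitioned (perturbed_metric d g).
  apply: finitely_partitionedD (finitely_partitioned_bounded g_bnd).
  exact: totally_bounded_finitely_partitioned.
exists (perturbed_metric d g); split.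
- exact: perturbed_metric_on.
- exact: finitely_partitioned_totally_bounded.
- apply: le_trans (h_BD_ge fp ltr01 (maxsep_coloured hd fp gc hc)).
  by rewrite lee_fin.
Qed.
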